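(* Let $R$ be a commutative noetherian ring and let $M\in \mathsf{D}_{\mathsf{b}}(R)$. Let $\mathsf{P}$ be the collection of all projective $R$-modules and $\mathsf{I}$ the collection of all injective $R$-modules. Then $$\operatorname{level}_R^{\mathsf{P}}(M) \le \operatorname{pd}_R(\mathrm{H}(M)^{\oplus}) + 1 \qquad\text{and}\qquad \operatorname{level}_R^{\mathsf{I}}(M) \le \operatorname{id}_R(\mathrm{H}(M)^{\oplus}) + 1 .$$
   Context: $\mathsf{D}(R)$ is the derived category of $R$; $\mathsf{D}_{\mathsf{b}}(R)$ is the full subcategory of complexes $M$ with bounded homology ($\mathrm{H}_i(M)=0$ for all $|i|\gg 0$). Complexes are graded homologically. $\mathrm{H}(M)^{\oplus} = \bigoplus_{i\in\mathbb{Z}} \mathrm{H}_i(M)$, an $R$-module. Level: for a nonempty collection $\mathsf{C}$ of objects of $\mathsf{D}(R)$ (modules are viewed as complexes concentrated in degree $0$), set $\operatorname{thick}_R^0(\mathsf{C}) = \{0\}$; $\operatorname{thick}_R^1(\mathsf{C})$ is the smallest collection of objects containing $\mathsf{C}$ and closed under isomorphism, shifts, finite direct sums and direct summands; for $n\ge 2$, $\operatorname{thick}_R^n(\mathsf{C})$ consists of all $M\in \mathsf{D}(R)$ for which there is a distinguished triangle $K \to L\oplus M \to N \to$ (for some object $L$) with $K\in \operatorname{thick}_R^1(\mathsf{C})$ and $N \in \operatorname{thick}_R^{n-1}(\mathsf{C})$. Then $\operatorname{level}_R^{\mathsf{C}}(M) = \inf\{n \mid M\in \operatorname{thick}_R^n(\mathsf{C})\}$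 (equal to $\infty$ if no such $n$ exists). $\operatorname{pd}_R$ and $\operatorname{id}_R$ are the projective and injective dimension of a module, i.e. the least $n\ge 0$ such that a projective (resp. injective) resolution of length $n$ exists, or $\infty$; with this convention the zero module has dimension $0$. *)

(* Defs.v *)
From HB Require Import structures.
From mathcomp Require Import all_boot all_order all_algebra.
From mathcomp Require Import generic_quotient ring_quotient.
From mathcomp Require Import boolp classical_sets cardinality constructive_ereal.

Set Implicit Arguments.
Unset Strict Implicit.
Unset Printing Implicit Defensive.
Import Order.TTheory GRing.Theory Num.Theory.
Local Open Scope ring_scope.
Local Open Scope quotient_scope.
Local Obligation Tactic := idtac.

(* Values in N u {oo} are represented in [\bar int]; inf of the empty set is
   +oo. *)
Definition einf (P : nat -> Prop) : \bar int :=
  match pselect (exists n, `[< P n >]) with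
  | left exP => ((ex_minn exP)%:Z)%:E
  | right _ => +oo%E
  end.

(* Ideals of R are the submodules of R^o; each one is finitely generated. *)
Definition noetherian (R : comPzRingType) : Prop :=
  forall I : {pred R^o}, submod_closed I ->
  exists s : seq R, forall x : R,
    x \in I <-> exists c : 'I_(size s) -> R, x = \sum_i c i * s`_i.

Section QuotientModule.
Variables (R : pzRingType) (V : lmodType R) (B : {pred V}).

(* [B] tagged with the proof that it is a submodule. *)
Definition submod_pred of submod_closed B : {pred V} := B.

Variable Bsub : submod_closed B.

HB.instance Definition _ := GRing.isZmodClosed.Build V (submod_pred Bsub)
  (GRing.submod_closedB Bsub).

Definition quot_mod := Quotient.quot (submod_pred Bsub).

HB.instance Definition _ := GRing.Zmodule.on quot_mod.

Definition quot_pi (x : V) : quot_mod := \pi_(Quotient.quot (submod_pred Bsub)) x.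
Definition quot_repr (q : quot_mod) : V := repr (q : Quotient.quot (submod_pred Bsub)).

Lemma quot_reprK q : quot_pi (quot_repr q) = q.
Proof. exact: reprK. Qed.

Lemma quot_piE x y : quot_pi x = quot_pi y <-> x - y \in B.
Proof.
rewrite /quot_pi; split => [/eqP|h]; first by rewrite -Quotient.idealrBE.
by apply/eqP; rewrite -Quotient.idealrBE.
Qed.

Lemma quot_piD x y : quot_pi (x + y) = quot_pi x + quot_pi y.
Proof. exact: raddfD. Qed.

Definition quot_scale (a : R) (q : quot_mod) : quot_mod :=
  quot_pi (a *: quot_repr q).

Lemma quot_piZ a x : quot_pi (a *: x) = quot_scale a (quot_pi x).
Proof.
apply/quot_piE; rewrite -scalerBr -[_ *: _]addr0; apply: Bsub.2; last exact: Bsub.1.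
by apply/quot_piE; rewrite quot_reprK.
Qed.

Lemma quot_scaleA a b q : quot_scale a (quot_scale b q) = quot_scale (a * b) q.
Proof. by rewrite -(quot_reprK q) -!quot_piZ scalerA. Qed.
Lemma quot_scale1 : left_id 1 quot_scale.
Proof. by move=> q; rewrite -(quot_reprK q) -!quot_piZ scale1r. Qed.
Lemma quot_scaleDr : right_distributive quot_scale +%R.
Proof.
move=> a q r; rewrite -(quot_reprK q) -(quot_reprK r).
by rewrite -quot_piD -!quot_piZ scalerDr quot_piD.
Qed.
Lemma quot_scaleDl q : {morph quot_scale^~ q : a b / a + b}.
Proof.
by move=> a b; rewrite -(quot_reprK q) -!quot_piZ scalerDl quot_piD.
Qed.

HB.instance Definition _ := GRing.Zmodule_isLmodule.Build R quot_mod
  quot_scaleA quot_scale1 quot_scaleDr quot_scaleDl.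

End QuotientModule.

Section DirectSum.
Variables (R : pzRingType) (I : Type) (V : I -> lmodType R).

Definition dprod := forall i : I, V i.

HB.instance Definition _ := Choice.on dprod.

Let add (f g : dprod) : dprod := fun i => f i + g i.
Let opp (f : dprod) : dprod := fun i => - f i.
Let zero : dprod := fun i => 0.
Let scale (a : R) (f : dprod) : dprod := fun i => a *: f i.

Let addA : associative add.
Proof. by move=> f g h; apply: functional_extensionality_dep => i; apply: addrA. Qed.
Let addC : commutative add.
Proof. by move=> f g; apply: functional_extensionality_dep => i; apply: addrC. Qed.
Let add0 : left_id zero add.
Proof. by move=> f; apply: functional_extensionality_dep => i; apply: add0r. Qed.
Let addN : left_inverse zero opp add.
Proof. by move=> f; apply: functional_extensionality_dep => i; apply: addNr. Qed.

HB.instance Definition _ := GRing.isZmodule.Build dprod addA addC add0 addN.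

Let scaleA a b f : scale a (scale b f) = scale (a * b) f.
Proof. by apply: functional_extensionality_dep => i; apply: scalerA. Qed.
Let scale1 : left_id 1 scale.
Proof. by move=> f; apply: functional_extensionality_dep => i; apply: scale1r. Qed.
Let scaleDr : right_distributive scale +%R.
Proof. by move=> a f g; apply: functional_extensionality_dep => i; apply: scalerDr. Qed.
Let scaleDl f : {morph scale^~ f : a b / a + b}.
Proof. by move=> a b; apply: functional_extensionality_dep => i; apply: scalerDl. Qed.

HB.instance Definition _ := GRing.Zmodule_isLmodule.Build R dprod
  scaleA scale1 scaleDr scaleDl.

Definition fin_supp : {pred dprod} :=
  fun f => `[< finite_set [set i | f i <> 0] >].

Lemma fin_supp_submod : submod_closed fin_supp.
Proof.
split=> [|a f g /asboolP hf /asboolP hg]; apply/asboolP.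
  by apply: (sub_finite_set _ (finite_set0 I)) => i /=; apply.
have hU : finite_set ([set i | f i <> 0] `|` [set i | g i <> 0])%classic.
  by rewrite finite_setU.
apply: (sub_finite_set _ hU) => i /= h.
have [f0|] := pselect (f i = 0); last by left.
right=> g0; apply: h; change (a *: f i + g i = 0).
by rewrite f0 g0 scaler0 addr0.
Qed.

HB.instance Definition _ := GRing.isSubmodClosed.Build R dprod fin_supp
  fin_supp_submod.

Record dsum := Dsum { dsum_val :> dprod; _ : dsum_val \in fin_supp }.
HB.instance Definition _ := [isSub for dsum_val].
HB.instance Definition _ := [Choice of dsum by <:].
HB.instance Definition _ := [SubChoice_isSubLmodule of dsum by <:].

End DirectSum.

Section Modules.
Variable R : comPzRingType.

Definition projective_module (P : lmodType R) : Prop :=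
  forall (A B : lmodType R) (g : {linear A -> B}) (f : {linear P -> B}),
    (forall y, exists x, g x = y) ->
    exists h : {linear P -> A}, forall x, g (h x) = f x.

Definition injective_module (E : lmodType R) : Prop :=
  forall (A B : lmodType R) (g : {linear A -> B}) (f : {linear A -> E}),
    injective g -> exists h : {linear B -> E}, forall x, h (g x) = f x.

Definition exact_at (A B C : lmodType R)
    (f : {linear A -> B}) (g : {linear B -> C}) : Prop :=
  forall y, g y = 0 <-> exists x, f x = y.

(* Resolutions are indexed by nat; having length (at most) [n] means vanishing
   in degrees > n. *)
Definition has_proj_resolution (V : lmodType R) (n : nat) : Prop :=
  exists (P : nat -> lmodType R) (d : forall k, {linear P k.+1 -> P k})
         (e : {linear P 0 -> V}),
  [/\ forall k, projective_module (P k),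
      forall k, (n < k)%N -> forall x : P k, x = 0,
      forall v, exists x, e x = v,
      exact_at (d 0) e
    & forall k, exact_at (d k.+1) (d k)].

Definition has_inj_resolution (V : lmodType R) (n : nat) : Prop :=
  exists (E : nat -> lmodType R) (d : forall k, {linear E k -> E k.+1})
         (e : {linear V -> E 0}),
  [/\ forall k, injective_module (E k),
      forall k, (n < k)%N -> forall x : E k, x = 0,
      injective e,
      exact_at e (d 0)
    & forall k, exact_at (d k) (d k.+1)].

Definition proj_dim (V : lmodType R) : \bar int := einf (has_proj_resolution V).
Definition inj_dim (V : lmodType R) : \bar int := einf (has_inj_resolution V).

End Modules.

(* Homological grading. *)
Record complex (R : comPzRingType) := Complex {
  cobj :> int -> lmodType R;
  cdiff : forall i, {linear cobj i -> cobj (i - 1)};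
  cdiffK : forall i (x : cobj i), cdiff (i - 1) (cdiff i x) = 0 }.
Arguments Complex {R} cobj cdiff cdiffK.
Arguments cdiff {R} c {i}.
Arguments cdiffK {R} c {i} x.

Record chain_map (R : comPzRingType) (X Y : complex R) := ChainMap {
  cmap :> forall i, {linear X i -> Y i};
  cmap_diff : forall i (x : X i), cmap (i - 1) (cdiff X x) = cdiff Y (cmap i x) }.

Arguments cmap_diff {R X Y} c {i} x.

Section Complexes.
Variable R : comPzRingType.
Implicit Types X Y Z : complex R.

Definition tr X i j (e : i = j) : {linear X i -> X j} :=
  match e in _ = k return {linear X i -> X k} with erefl => idfun end.

Lemma tr_diff X i j (e : i = j) (e' : i - 1 = j - 1) (x : X i) :
  cdiff X (tr X e x) = tr X e' (cdiff X x).
Proof. by case: j / e e' => e'; rewrite (eq_irrelevance e' erefl). Qed.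

Lemma tr_map X Y (f : chain_map X Y) i j (e : i = j) (x : X i) :
  f j (tr X e x) = tr Y e (f i x).
Proof. by case: j / e. Qed.

Program Definition chain_id X : chain_map X X := ChainMap (cmap := fun i => idfun) _.
Next Obligation. by []. Qed.

Program Definition chain_comp X Y Z (g : chain_map Y Z) (f : chain_map X Y) :
  chain_map X Z := ChainMap (cmap := fun i => g i \o f i) _.
Next Obligation. by move=> X Y Z g f i x /=; rewrite !cmap_diff. Qed.

Definition is_cycle X i : {pred X i} := fun x => cdiff X x == 0.

Lemma is_cycle_submod X i : submod_closed (@is_cycle X i).
Proof.
split=> [|a x y]; rewrite /is_cycle !unfold_in ?linear0 //.
by move=> /eqP hx /eqP hy; rewrite linearP hx hy scaler0 addr0.
Qed.

HB.instance Definition _ X i := GRing.isSubmodClosed.Build R (X i) (@is_cycle X i)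
  (is_cycle_submod X i).

Record cycle X i := Cycle { cycle_val : X i; _ : cycle_val \in @is_cycle X i }.
HB.instance Definition _ X i := [isSub for @cycle_val X i].
HB.instance Definition _ X i := [Choice of cycle X i by <:].
HB.instance Definition _ X i := [SubChoice_isSubLmodule of cycle X i by <:].

Lemma cycle_inj X i : injective (@cycle_val X i).
Proof. exact: val_inj. Qed.

Lemma cycleP X i (z : cycle X i) : cdiff X (val z) = 0.
Proof. by case: z => x /= /eqP. Qed.

Lemma addrK1 (i : int) : i + 1 - 1 = i.
Proof. exact: addrK. Qed.

Definition is_boundary X i : {pred cycle X i} :=
  fun z => `[< exists y : X (i + 1), tr X (addrK1 i) (cdiff X y) = val z >].

Lemma is_boundary_submod X i : submod_closed (@is_boundary X i).
Proof.
split=> [|a x y /asboolP[u hu] /asboolP[v hv]]; apply/asboolP.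
  by exists 0; rewrite !linear0.
by exists (a *: u + v); rewrite !linearP hu hv.
Qed.

Definition homology X i : lmodType R := quot_mod (is_boundary_submod X i).

Definition homology_class X i (z : cycle X i) : homology X i := quot_pi _ z.

Definition homology_sum X : lmodType R := dsum (homology X).

Definition bounded_homology X : Prop :=
  exists N : nat, forall i : int, (N%:Z < `|i|) -> forall h : homology X i, h = 0.

Lemma cycle_map_subproof X Y (f : chain_map X Y) i (z : cycle X i) :
  f i (val z) \in @is_cycle Y i.
Proof. by rewrite unfold_in /is_cycle -cmap_diff cycleP linear0. Qed.

Definition cycle_map X Y (f : chain_map X Y) i (z : cycle X i) : cycle Y i :=
  Cycle (cycle_map_subproof f z).

Definition homology_map X Y (f : chain_map X Y) i (h : homology X i) :
  homology Y i := homology_class (cycle_map f (quot_repr h)).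

Lemma homology_mapE X Y (f : chain_map X Y) i (z : cycle X i) :
  homology_map f (homology_class z) = homology_class (cycle_map f z).
Proof.
apply/quot_piE.
have /quot_piE/asboolP[y hy] := quot_reprK (homology_class z).
apply/asboolP; exists (f _ y); rewrite -cmap_diff -tr_map hy.
exact: linearB.
Qed.

Definition qis X Y (f : chain_map X Y) : Prop :=
  forall i, bijective (@homology_map X Y f i).

Program Definition zero_complex : complex R :=
  Complex (fun=> 'rV[R]_0 : lmodType R) (fun i => \0) _.
Next Obligation. by []. Qed.

Program Definition stalk (V : lmodType R) : complex R :=
  Complex (fun i => if i == 0 then V else ('rV[R]_0 : lmodType R))
          (fun i => \0) _.
Next Obligation. by []. Qed.

Definition csum_diff X Y i (x : X i * Y i) : X (i - 1) * Y (i - 1) :=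
  (cdiff X x.1, cdiff Y x.2).

Lemma csum_diff_linear X Y i : linear (@csum_diff X Y i).
Proof. by move=> a [x y] [x' y']; rewrite /csum_diff /= !linearP. Qed.

HB.instance Definition _ X Y i := GRing.isLinear.Build R _ _ _ (@csum_diff X Y i)
  (@csum_diff_linear X Y i).

Program Definition csum X Y : complex R :=
  Complex (fun i => (X i * Y i)%type : lmodType R) (fun i => @csum_diff X Y i) _.
Next Obligation. by move=> X Y i x; rewrite /= /csum_diff /= !cdiffK. Qed.

Lemma shift_eq (n i : int) : i - n - 1 = i - 1 - n.
Proof. exact: addrAC. Qed.

(* (Sigma^n X)_i = X_(i-n), with differential (-1)^n d. *)
Definition shift_diff (n : int) X i (x : X (i - n)) : X (i - 1 - n) :=
  (-1) ^+ `|n|%N *: tr X (shift_eq n i) (cdiff X x).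

Lemma shift_diff_linear n X i : linear (@shift_diff n X i).
Proof.
move=> a x y; rewrite /shift_diff linearP [tr _ _ _]linearP scalerDr !scalerA.
by congr (_ *: _ + _); rewrite mulrC.
Qed.

HB.instance Definition _ n X i := GRing.isLinear.Build R _ _ _ (@shift_diff n X i)
  (@shift_diff_linear n X i).

Program Definition shift (n : int) X : complex R :=
  Complex (fun i => X (i - n)) (fun i => @shift_diff n X i) _.
Next Obligation.
move=> n X i x; rewrite /= /shift_diff !linearZ /=.
rewrite (tr_diff _ (congr1 (fun k => k - 1) (shift_eq n i))) cdiffK.
by rewrite !linear0.
Qed.

Program Definition shift_map n X Y (f : chain_map X Y) :
  chain_map (shift n X) (shift n Y) := ChainMap (cmap := fun i => f (i - n)) _.
Next Obligation.
by move=> n X Y f i x; rewrite /= /shift_diff linearZ tr_map cmap_diff.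
Qed.

(* Cone(f)_i = Y_i (+) X_(i-1), so that the standard triangle is
   X -> Y -> Cone(f) -> Sigma X. *)
Definition cone_diff X Y (f : chain_map X Y) i (x : Y i * X (i - 1)) :
    Y (i - 1) * X (i - 1 - 1) :=
  (cdiff Y x.1 + f (i - 1) x.2, - cdiff X x.2).

Lemma cone_diff_linear X Y (f : chain_map X Y) i : linear (@cone_diff X Y f i).
Proof.
move=> a [x y] [x' y']; congr pair; rewrite /= !linearP //.
by rewrite scalerDr addrACA.
Qed.

HB.instance Definition _ X Y f i := GRing.isLinear.Build R _ _ _
  (@cone_diff X Y f i) (@cone_diff_linear X Y f i).

Program Definition cone X Y (f : chain_map X Y) : complex R :=
  Complex (fun i => (Y i * X (i - 1))%type : lmodType R)
          (fun i => @cone_diff X Y f i) _.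
Next Obligation.
move=> X Y f i x; rewrite /= /cone_diff /=.
by rewrite linearD !linearN /= cmap_diff !cdiffK add0r subrr; congr pair; rewrite opprK.
Qed.

Definition cone_inl_fun X Y (f : chain_map X Y) i (y : Y i) : Y i * X (i - 1) :=
  (y, 0).

Lemma cone_inl_linear X Y (f : chain_map X Y) i : linear (@cone_inl_fun X Y f i).
Proof.
by move=> a x y; rewrite /cone_inl_fun; congr pair; rewrite /= scaler0 addr0.
Qed.

HB.instance Definition _ X Y f i := GRing.isLinear.Build R _ _ _
  (@cone_inl_fun X Y f i) (@cone_inl_linear X Y f i).

Program Definition cone_in X Y (f : chain_map X Y) : chain_map Y (cone f) :=
  ChainMap (cmap := fun i => @cone_inl_fun X Y f i) _.
Next Obligation.
by move=> X Y f i y; rewrite /= /cone_inl_fun /cone_diff /= !linear0 addr0.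
Qed.

Program Definition cone_out X Y (f : chain_map X Y) :
  chain_map (cone f) (shift 1 X) := ChainMap (cmap := fun i => snd) _.
Next Obligation.
move=> X Y f i y; rewrite /= /shift_diff /cone_diff /= expr1 scaleN1r.
by rewrite (eq_irrelevance (shift_eq 1 i) erefl).
Qed.

Lemma qisP X Y (f : chain_map X Y) : qis f <->
  (forall i (z : cycle X i), cycle_map f z \in @is_boundary Y i ->
     z \in @is_boundary X i) /\
  (forall i (w : cycle Y i), exists z : cycle X i,
     w - cycle_map f z \in @is_boundary Y i).
Proof.
split=> [fq|[finj fsur] i].
  split=> i => [z hz|w]; have [g fK gK] := fq i.
    have h0 : homology_map f (homology_class z) = homology_map f (homology_class 0).
      rewrite !homology_mapE; apply/quot_piE.
      suff -> : cycle_map f (0 : cycle X i) = 0 by rewrite subr0.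
      by apply: cycle_inj; rewrite /= linear0.
    have /quot_piE : homology_class z = homology_class 0.
      exact: (can_inj fK h0).
    by rewrite subr0.
  exists (quot_repr (g (homology_class w))).
  exact/(quot_piE (is_boundary_submod Y i))/esym/gK.
have inj : injective (@homology_map X Y f i).
  move=> h k; rewrite -(quot_reprK h) -(quot_reprK k).
  rewrite -/(homology_class _) -/(homology_class (quot_repr k)) !homology_mapE.
  move=> /quot_piE hb; apply/quot_piE/finj.
  suff -> : cycle_map f (quot_repr h - quot_repr k) =
    cycle_map f (quot_repr h) - cycle_map f (quot_repr k) by [].
  by apply: cycle_inj; rewrite /= linearB.
have sur (w : homology Y i) : exists h, homology_map f h = w.
  have [z hz] := fsur i (quot_repr w); exists (homology_class z).
  rewrite homology_mapE -[RHS]quot_reprK; apply: esym.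
  exact/quot_piE.
pose g w := projT1 (cid (sur w)).
by exists g => [h|w]; [apply: inj|]; rewrite /g; case: cid.
Qed.

Lemma tr_irr X i j (e e' : i = j) (x : X i) : tr X e x = tr X e' x.
Proof. by rewrite (eq_irrelevance e e'). Qed.

Lemma tr_tr X i j k (e : i = j) (e' : j = k) (x : X i) :
  tr X e' (tr X e x) = tr X (etrans e e') x.
Proof. by case: k / e'. Qed.

Lemma is_boundaryP X i (z : cycle X i) : z \in @is_boundary X i <->
  exists j (e : j - 1 = i) (y : X j), tr X e (cdiff X y) = val z.
Proof.
split=> [/asboolP[y hy]|[j [e [y hy]]]]; first by exists (i + 1), (addrK1 i), y.
apply/asboolP; have e' : j = i + 1 by rewrite -e subrK.
by exists (tr X e' y); rewrite -hy; case: _ / e' (addrK1 i) => e'; apply: tr_irr.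
Qed.

Lemma tr_shift n X i j (e : i = j) (e' : i - n = j - n) (x : shift n X i) :
  tr (shift n X) e x = tr X e' x.
Proof. by case: j / e e' => e'; rewrite (eq_irrelevance e' erefl). Qed.

Lemma sign_invol (V : lmodType R) (n : nat) (x : V) :
  (-1) ^+ n *: ((-1) ^+ n *: x) = x.
Proof. by rewrite scalerA -expr2 sqrr_sign scale1r. Qed.

Lemma shift_cycle n X i (x : X (i - n)) :
  (x \in @is_cycle (shift n X) i) = (x \in @is_cycle X (i - n)).
Proof.
apply/eqP/eqP => /= [h|h]; last by rewrite /shift_diff h !linear0.
have := congr1 (fun y => (-1) ^+ `|n|%N *: y) h.
rewrite /shift_diff /= sign_invol scaler0 => {}h.
have := congr1 (tr X (esym (shift_eq n i))) h.
by rewrite tr_tr linear0 (tr_irr _ erefl).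
Qed.

Lemma shift_boundary n X i (z : cycle (shift n X) i) (z' : cycle X (i - n)) :
  val z = val z' -> (z \in @is_boundary (shift n X) i) <->
                    (z' \in @is_boundary X (i - n)).
Proof.
move=> zz'; rewrite !is_boundaryP zz'; split.
  move=> [j [e [y hy]]]; exists (j - n), (etrans (shift_eq n j) (congr1 (fun k => k - n) e)).
  exists ((-1) ^+ `|n|%N *: y); rewrite -hy (tr_shift e (congr1 (fun k => k - n) e)).
  by rewrite /= /shift_diff !linearZ /= tr_tr.
move=> [j [e [y hy]]].
have e1 : j = j + n - n by rewrite addrK.
have e2 : j + n - 1 = i by rewrite addrAC e subrK.
exists (j + n), e2, ((-1) ^+ `|n|%N *: tr X e1 y); rewrite -hy.
rewrite (tr_shift e2 (congr1 (fun k => k - n) e2)) /= /shift_diff !linearZ /=.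
rewrite sign_invol (tr_diff _ (congr1 (fun k => k - 1) e1)) !tr_tr.
exact: tr_irr.
Qed.

Lemma shift_qis n X Y (f : chain_map X Y) : qis f -> qis (shift_map n f).
Proof.
move=> /qisP[finj fsur]; apply/qisP; split=> i.
  case=> z hz; have hz' := hz; rewrite shift_cycle in hz'.
  have hb := @shift_boundary n X i (Cycle hz) (Cycle hz') erefl.
  have hc := @shift_boundary n Y i (cycle_map (shift_map n f) (Cycle hz))
    (cycle_map f (Cycle hz')) erefl.
  by move=> h; apply/hb.2/finj/hc.1.
case=> w hw; have hw' := hw; rewrite shift_cycle in hw'.
have [[z hz'] hb] := fsur _ (Cycle hw'); have hz := hz'.
rewrite -shift_cycle in hz; exists (Cycle hz).
by apply: (@shift_boundary n Y i _ _ _).2 hb.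
Qed.

End Complexes.

(* The derived category D(R), as the localization of the category of complexes
   at the quasi-isomorphisms: morphisms are formal composites of chain maps and
   of formal inverses of quasi-isomorphisms, considered up to [deq]. *)
Inductive dhom (R : comPzRingType) : complex R -> complex R -> Type :=
| DMap X Y (f : chain_map X Y) : dhom X Y
| DInv X Y (f : chain_map X Y) of qis f : dhom Y X
| DComp X Y Z (v : dhom Y Z) (u : dhom X Y) : dhom X Z.

Inductive deq (R : comPzRingType) :
  forall X Y : complex R, dhom X Y -> dhom X Y -> Prop :=
| deq_refl X Y (u : dhom X Y) : deq u u
| deq_sym X Y (u v : dhom X Y) : deq u v -> deq v u
| deq_trans X Y (u v w : dhom X Y) : deq u v -> deq v w -> deq u w
| deq_congr X Y Z (u u' : dhom X Y) (v v' : dhom Y Z) :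
    deq u u' -> deq v v' -> deq (DComp v u) (DComp v' u')
| deq_assoc W X Y Z (u : dhom W X) (v : dhom X Y) (w : dhom Y Z) :
    deq (DComp w (DComp v u)) (DComp (DComp w v) u)
| deq_idl X Y (u : dhom X Y) : deq (DComp (DMap (chain_id Y)) u) u
| deq_idr X Y (u : dhom X Y) : deq (DComp u (DMap (chain_id X))) u
| deq_map X Y (f g : chain_map X Y) :
    (forall i x, f i x = g i x) -> deq (DMap f) (DMap g)
| deq_comp X Y Z (f : chain_map X Y) (g : chain_map Y Z) :
    deq (DMap (chain_comp g f)) (DComp (DMap g) (DMap f))
| deq_invl X Y (f : chain_map X Y) (hf : qis f) :
    deq (DComp (DInv hf) (DMap f)) (DMap (chain_id X))
| deq_invr X Y (f : chain_map X Y) (hf : qis f) :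
    deq (DComp (DMap f) (DInv hf)) (DMap (chain_id Y)).

Section DerivedCategory.
Variable R : comPzRingType.
Implicit Types X Y Z K L M N : complex R.

Fixpoint dshift (n : int) X Y (u : dhom X Y) : dhom (shift n X) (shift n Y) :=
  match u with
  | DMap _ _ f => DMap (shift_map n f)
  | DInv _ _ _ hf => DInv (shift_qis n hf)
  | DComp _ _ _ v u => DComp (dshift n v) (dshift n u)
  end.

Definition is_diso X Y (u : dhom X Y) : Prop :=
  exists v : dhom Y X, deq (DComp v u) (DMap (chain_id X)) /\
                       deq (DComp u v) (DMap (chain_id Y)).

Definition diso X Y : Prop := exists u : dhom X Y, is_diso u.

(* Distinguished triangles X -> Y -> Z -> Sigma X: those isomorphic to the
   standard triangle of a chain map. *)
Definition distinguished X Y Z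
    (u : dhom X Y) (v : dhom Y Z) (w : dhom Z (shift 1 X)) : Prop :=
  exists (A B : complex R) (f : chain_map A B)
         (a : dhom X A) (b : dhom Y B) (c : dhom Z (cone f)),
  [/\ is_diso a, is_diso b & is_diso c] /\
  [/\ deq (DComp b u) (DComp (DMap f) a),
      deq (DComp c v) (DComp (DMap (cone_in f)) b)
    & deq (DComp (dshift 1 a) w) (DComp (DMap (cone_out f)) c)].

(* Closure under [diso] is part of the definition, so [thick1_summand] covers
   every direct summand in D(R), and binary sums together with
   [zero_complex] give all finite direct sums. *)
Inductive thick1 (C : complex R -> Prop) : complex R -> Prop :=
| thick1_incl X : C X -> thick1 C X
| thick1_iso X Y : diso X Y -> thick1 C X -> thick1 C Y
| thick1_shift n X : thick1 C X -> thick1 C (shift n X)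
| thick1_zero : thick1 C (zero_complex R)
| thick1_sum X Y : thick1 C X -> thick1 C Y -> thick1 C (csum X Y)
| thick1_summand X Y : thick1 C (csum X Y) -> thick1 C X.

(* thick^0 = {0}, with objects taken up to isomorphism in D(R). *)
Fixpoint thick (C : complex R -> Prop) (n : nat) (M : complex R) : Prop :=
  match n with
  | 0 => diso M (zero_complex R)
  | 1 => thick1 C M
  | n'.+1 =>
      exists (K L N : complex R) (u : dhom K (csum L M))
             (v : dhom (csum L M) N) (w : dhom N (shift 1 K)),
      [/\ distinguished u v w, thick1 C K & thick C n' N]
  end.

Definition level (C : complex R -> Prop) (M : complex R) : \bar int :=
  einf (fun n => thick C n M).

(* Modules as complexes concentrated in degree 0. *)
Inductive stalks (Q : lmodType R -> Prop) : complex R -> Prop :=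
| Stalk V : Q V -> stalks Q (stalk V).

End DerivedCategory.

(* Main.v *)
(* Put L := the complex with zero differential and L_i a complement of H_i(M) in
   H := H(M)^(+). In a bounded window of degrees L (+) M has homology H, and since
   thick^n is built from triangles K -> L (+) M -> N, no Schanuel argument is
   needed to pass from H to its summands H_i(M).

   Projective case: if P ->> H is the start of a projective resolution, lift it to
   cycles to get a chain map f from a sum of shifts of P to the complex, onto in
   homology; the homology of cone f is a shift of ker(P -> H), so induct.

   Injective case: dually, an embedding H -> E extends to g : T -> Sigma I, and the
   homology of the fibre F of g is E / H. Inductively F ~ S with S an iterated
   cone, and T ~ cone(I -> F -> S). An iterated cone can be peeled off from the
   other end, which gives the triangles with the first term in thick^1. *)
From HB Require Import structures.
From mathcomp Require Import all_boot all_order all_algebra.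
From mathcomp Require Import boolp classical_sets cardinality constructive_ereal.
Require Import Defs.

Set Implicit Arguments.
Unset Strict Implicit.
Unset Printing Implicit Defensive.
Import Order.TTheory GRing.Theory Num.Theory.
Local Open Scope ring_scope.

(** * Infima, dependent choice and kernels of linear maps *)

Lemma einf_le_succ (P Q : nat -> Prop) :
  (forall n, Q n -> P n.+1) -> (einf P <= einf Q + 1%:E)%E.
Proof.
(* If [Q] never holds, the right side is [+oo]; only the case of a finite infimum remains. *)
move=> QP; rewrite [einf Q]/einf; case: pselect => [exQ|_]; last by rewrite leey.
case: ex_minnP => n /asboolP /QP Pn1 _; rewrite /einf.
case: pselect => [exP|[]]; last by exists n.+1; apply/asboolP.
case: ex_minnP => m _ /(_ n.+1 (asboolT Pn1)) mn.
by rewrite -EFinD lee_fin -PoszD addn1 lez_nat.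
Qed.

Lemma dchoice (I : Type) (T : I -> Type) (P : forall i, T i -> Prop) :
  (forall i, exists y, P i y) -> exists f : forall i, T i, forall i, P i (f i).
Proof. by move=> h; exists (fun i => sval (cid (h i))) => i; case: cid. Qed.

Section Linear.
Variable R : comPzRingType.
Implicit Types A B C V : lmodType R.

Definition mklin A B (f : A -> B) (fL : linear f) : {linear A -> B} :=
  HB.pack f (GRing.isLinear.Build R A B *:%R f fL).

Definition in_ker A B (f : {linear A -> B}) : {pred A} := fun x => f x == 0.

Lemma in_ker_submod A B (f : {linear A -> B}) : submod_closed (in_ker f).
Proof.
split=> [|a x y]; rewrite /in_ker !unfold_in ?linear0 //.
by move=> /eqP fx /eqP fy; rewrite linearP fx fy scaler0 addr0.
Qed.

HB.instance Definition _ A B (f : {linear A -> B}) :=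
  GRing.isSubmodClosed.Build R A (in_ker f) (in_ker_submod f).

Record kermod A B (f : {linear A -> B}) :=
  Kermod { ker_val : A; _ : ker_val \in in_ker f }.
HB.instance Definition _ A B (f : {linear A -> B}) := [isSub for @ker_val A B f].
HB.instance Definition _ A B (f : {linear A -> B}) := [Choice of kermod f by <:].
HB.instance Definition _ A B (f : {linear A -> B}) :=
  [SubChoice_isSubLmodule of kermod f by <:].

Lemma kerP A B (f : {linear A -> B}) (k : kermod f) : f (val k) = 0.
Proof. by case: k => x /= /eqP. Qed.

Definition mkker A B (f : {linear A -> B}) (x : A) (fx : f x = 0) : kermod f :=
  Kermod (introT eqP fx : x \in in_ker f).

Definition ker_incl A B (f : {linear A -> B}) : {linear kermod f -> A} := val.

(** Transparent, so that the underlying element of an image reduces to [g x]. *)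
Definition ker_corestr A B C (f : {linear B -> C}) (g : {linear A -> B})
    (fg : forall x, f (g x) = 0) : {linear A -> kermod f}.
Proof.
apply: (@mklin _ _ (fun x => mkker (fg x))) => a x y.
by apply: val_inj; rewrite /= linearP.
Defined.

End Linear.

(** * Dimension shifting in resolutions *)

Definition trivial_module (R : comPzRingType) (V : lmodType R) : Prop :=
  forall x : V, x = 0.

Section Resolutions.
Variable R : comPzRingType.
Implicit Types A B C V P E : lmodType R.

Lemma linear_inverse A B (f : {linear A -> B}) :
  injective f -> (forall y, exists x, f x = y) ->
  exists g : {linear B -> A}, cancel f g /\ cancel g f.
Proof.
move=> finj /choice[g fK].
have gL : linear g by move=> a x y; apply: finj; rewrite linearP !fK.
by exists (mklin gL); split=> [x|y]; [apply: finj; rewrite fK|exact: fK].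
Qed.

Lemma trivial_projective V : trivial_module V -> projective_module V.
Proof. by move=> V0 A B g f _; exists \0 => x; rewrite (V0 x) !linear0. Qed.

Lemma trivial_injective V : trivial_module V -> injective_module V.
Proof. by move=> V0 A B g f _; exists \0 => x; rewrite [RHS]V0. Qed.

Lemma trivial_proj_resolution V n : trivial_module V -> has_proj_resolution V n.
Proof.
move=> V0; exists (fun=> V), (fun=> \0), \0; split=> // [k|v|y|k y].
- exact: trivial_projective.
- by exists 0; rewrite linear0 [RHS]V0.
- by split=> _; [exists 0; rewrite linear0 [RHS]V0|exact: V0].
- by split=> _; [exists 0; rewrite linear0 [RHS]V0|exact: V0].
Qed.

Lemma trivial_inj_resolution V n : trivial_module V -> has_inj_resolution V n.
Proof.
move=> V0; exists (fun=> V), (fun=> \0), \0; split=> // [k|x y _|y|k y].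
- exact: trivial_injective.
- by rewrite (V0 x) (V0 y).
- by split=> _; [exists 0; rewrite linear0 [RHS]V0|exact: V0].
- by split=> _; [exists 0; rewrite linear0 [RHS]V0|exact: V0].
Qed.

(** Since [P 1 = 0], the augmentation is an isomorphism [P 0 -> V], along which projectivity is
    transported. *)
Lemma proj_resolution0 V : has_proj_resolution V 0 -> projective_module V.
Proof.
move=> [P [d [e [Pproj Pvan esur ex0 _]]]].
have einj : injective e.
  apply: raddf_inj => x /ex0[y <-].
  by rewrite (Pvan 1 _ y) ?linear0.
have [s [eK sK]] := linear_inverse einj esur.
move=> A B g f gsur; have [h hE] := Pproj 0 _ _ g (f \o e) gsur.
by exists (h \o s) => x /=; rewrite hE /= sK.
Qed.

Lemma inj_resolution0 V : has_inj_resolution V 0 -> injective_module V.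
Proof.
move=> [E [d [e [Einj Evan einj ex0 _]]]].
have esur y : exists x, e x = y.
  by apply/ex0; apply: (Evan 1).
have [s [eK sK]] := linear_inverse einj esur.
move=> A B g f ginj; have [h hE] := Einj 0 _ _ g (e \o f) ginj.
by exists (s \o h) => x /=; rewrite hE /= eK.
Qed.

(** Cutting off degree 0 leaves a resolution of the first syzygy. *)
Lemma proj_resolutionS V n : has_proj_resolution V n.+1 ->
  exists P (e : {linear P -> V}), [/\ projective_module P,
    forall v, exists x, e x = v & has_proj_resolution (kermod e) n].
Proof.
move=> [P [d [e [Pproj Pvan esur ex0 ex]]]]; exists (P 0), e; split=> //.
have ed x : e (d 0 x) = 0 by apply/ex0; exists x.
exists (fun k => P k.+1), (fun k => d k.+1), (ker_corestr ed); split=> //.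
- by move=> k nk; apply: Pvan.
- move=> v; have /ex0[x xv] := kerP v.
  by exists x; apply: val_inj.
- move=> y; split=> [/(congr1 val) /= /ex //|/ex dy].
  exact: val_inj.
Qed.

(** The cokernel of [V -> E 0] is realised as the kernel of [d 1], which by exactness is the image
    of [d 0]; this avoids quotients. *)
Lemma inj_resolutionS V n : has_inj_resolution V n.+1 ->
  exists E C (a : {linear V -> E}) (p : {linear E -> C}),
    [/\ injective_module E, injective a, forall c, exists x, p x = c,
        exact_at a p & has_inj_resolution C n].
Proof.
move=> [E [d [e [Einj Evan einj ex0 ex]]]].
have dd x : d 1 (d 0 x) = 0 by apply/ex; exists x.
exists (E 0), (kermod (d 1)), e, (ker_corestr dd); split=> //.
- move=> c; have /ex[x xc] := kerP c.
  by exists x; apply: val_inj.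
- move=> y; split=> [/(congr1 val) /= /ex0 //|/ex0 dy].
  exact: val_inj.
exists (fun k => E k.+1), (fun k => d k.+1), (ker_incl (d 1)); split=> //.
- by move=> k nk; apply: Evan.
- exact: val_inj.
- move=> y; split=> [y0|[x <-]]; last exact: kerP.
  by exists (mkker y0).
Qed.

End Resolutions.

(** * Quasi-isomorphisms, short exact sequences and triangles *)

Section ChainLevel.
Variable R : comPzRingType.
Implicit Types X Y Z K L M N T S : complex R.

Lemma levelwise_qis X Y (f : chain_map X Y) :
  (forall i, injective (f i)) -> (forall i y, exists x, f i x = y) -> qis f.
Proof.
move=> finj fsur; apply/qisP; split=> i.
  move=> z /is_boundaryP[j [e [y hy]]]; apply/is_boundaryP; exists j, e.
  case: i / e z hy => z /= dy; have [x xy] := fsur _ y.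
  by exists x; apply: finj; rewrite cmap_diff xy.
move=> w; have [x xw] := fsur _ (val w).
have dx : x \in @is_cycle R X i.
  by apply/eqP/finj; rewrite cmap_diff xw cycleP linear0.
exists (Cycle dx); apply/is_boundaryP; exists (i + 1), (addrK1 i), 0.
by rewrite !linear0 /= xw subrr.
Qed.

Lemma qis_diso X Y (f : chain_map X Y) : qis f -> diso X Y.
Proof.
by move=> hf; exists (DMap f), (DInv hf); split; [apply: deq_invl|apply: deq_invr].
Qed.

Lemma diso_sym X Y : diso X Y -> diso Y X.
Proof. by case=> u [v [vu uv]]; exists v, u. Qed.

Definition csum_snd_fun X Y i : {linear csum X Y i -> Y i} := snd.
Definition csum_snd X Y : chain_map (csum X Y) Y :=
  ChainMap (cmap := @csum_snd_fun X Y) (fun _ _ => erefl).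

(** Lets a complex be treated as a summand with zero complement, so that inductions stated for
    [csum L M] can be applied to a single complex. *)
Lemma csum_zero_qis Y : qis (csum_snd (zero_complex R) Y).
Proof.
apply: levelwise_qis => i => [[a y] [b y'] /= ->|y]; last by exists (0, y).
by congr pair; apply/rowP => -[].
Qed.

Definition csum_swap_fun X Y i (x : csum X Y i) : csum Y X i := (x.2, x.1).

Lemma csum_swap_linear X Y i : linear (@csum_swap_fun X Y i).
Proof. by []. Qed.

Definition csum_swap X Y : chain_map (csum X Y) (csum Y X) :=
  ChainMap (cmap := fun i => mklin (@csum_swap_linear X Y i)) (fun _ _ => erefl).

Lemma csum_swap_qis X Y : qis (csum_swap X Y).
Proof.
by apply: levelwise_qis => i [x y]; [case=> x' y' [-> ->]|exists (y, x)].
Qed.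

Definition short_exact K T N (f : chain_map K T) (p : chain_map T N) : Prop :=
  [/\ forall i, injective (f i), forall i n, exists t, p i t = n
    & forall i, exact_at (f i) (p i)].

Section ConeOfShortExact.
Variables (K T N : complex R) (f : chain_map K T) (p : chain_map T N).
Hypothesis fp : short_exact f p.

Definition cone_proj_fun i (x : cone f i) : N i := p i x.1.

Lemma cone_proj_linear i : linear (@cone_proj_fun i).
Proof. by move=> a x y; rewrite /cone_proj_fun /= linearP. Qed.

Lemma cone_proj_diff i (x : cone f i) :
  mklin (@cone_proj_linear (i - 1)) (cdiff (cone f) x) =
  cdiff N (mklin (@cone_proj_linear i) x).
Proof.
case: fp => _ _ ex; rewrite /= /cone_proj_fun /= linearD cmap_diff.
have -> : p (i - 1) (f (i - 1) x.2) = 0 by apply/ex; exists x.2.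
exact: addr0.
Qed.

Definition cone_proj : chain_map (cone f) N := ChainMap cone_proj_diff.

Lemma cone_proj_qis : qis cone_proj.
Proof.
case: fp => finj psur ex; apply/qisP; split=> i.
  move=> z /is_boundaryP[j [e [n hn]]]; apply/is_boundaryP; exists j, e.
  case: i / e z hn => -[[t k] hz] /= dn; have [t' t'n] := psur _ n.
  have [/= dt dk] : cdiff T t + f _ k = 0 /\ - cdiff K k = 0.
    by move/eqP: (hz) => -[].
  (* The difference between [t] and the boundary of the lift [t'] dies in [N], so it comes from [K]
     and supplies the second component of the bounding element. *)
  have [k' hk'] : exists k', f _ k' = t - cdiff T t'.
    by apply/ex; rewrite linearB /= cmap_diff t'n dn subrr.
  exists (t', k'); rewrite /= /cone_diff /=; congr pair.
    by rewrite hk' (addrC (cdiff T t')) subrK.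
  apply: finj; rewrite linearN /= cmap_diff hk' linearB /= cdiffK subr0.
  exact: addr0_eq dt.
move=> w; have [t tw] := psur _ (val w).
have [k hk] : exists k, f _ k = cdiff T t.
  by apply/ex; rewrite cmap_diff tw cycleP.
have dz : ((t, - k) : cone f i) \in @is_cycle R (cone f) i.
  apply/eqP; rewrite /= /cone_diff /=; congr pair.
    by rewrite linearN hk subrr.
  by apply: finj; rewrite !linearN opprK cmap_diff hk cdiffK linear0.
exists (Cycle dz); apply/is_boundaryP; exists (i + 1), (addrK1 i), 0.
by rewrite !linear0 /= /cone_proj_fun /= tw subrr.
Qed.

End ConeOfShortExact.

Lemma is_diso_id X : is_diso (DMap (chain_id X)).
Proof. by exists (DMap (chain_id X)); split; apply: deq_idl. Qed.

Lemma is_diso_qis X Y (q : chain_map X Y) : qis q -> is_diso (DMap q).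
Proof.
by move=> hq; exists (DInv hq); split; [apply: deq_invl|apply: deq_invr].
Qed.

Lemma is_diso_inv X Y (q : chain_map X Y) (hq : qis q) : is_diso (DInv hq).
Proof. by exists (DMap q); split; [apply: deq_invr|apply: deq_invl]. Qed.

Lemma deq_cancell X Y Z (q : chain_map Y Z) (hq : qis q) (u : dhom X Z) :
  deq (DComp (DMap q) (DComp (DInv hq) u)) u.
Proof.
apply: deq_trans (deq_assoc _ _ _) _; apply: deq_trans (deq_idl u).
exact: deq_congr (deq_refl _) (deq_invr hq).
Qed.

Lemma deq_cancelr X Y Z (q : chain_map Y Z) (hq : qis q) (u : dhom X Y) :
  deq (DComp (DInv hq) (DComp (DMap q) u)) u.
Proof.
apply: deq_trans (deq_assoc _ _ _) _; apply: deq_trans (deq_idl u).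
exact: deq_congr (deq_refl _) (deq_invl hq).
Qed.

(** The standard triangle of [f], with [T] replaced by [csum L M] along [q] and the cone by [N]
    along [r], has the shape that [thick] asks for. The indices are successors because [thick] has a
    separate clause at 1. *)
Lemma thickS (C : complex R -> Prop) n K T N M L
    (f : chain_map K T) (r : chain_map (cone f) N) (q : chain_map (csum L M) T) :
  qis r -> qis q -> thick1 C K -> thick C n.+1 N -> thick C n.+2 M.
Proof.
move=> hr hq CK CN; exists K, L, N, (DComp (DInv hq) (DMap f)),
  (DComp (DMap r) (DComp (DMap (cone_in f)) (DMap q))),
  (DComp (DMap (cone_out f)) (DInv hr)); split=> //.
exists K, T, f, (DMap (chain_id K)), (DMap q), (DInv hr).
split; first by split; [apply: is_diso_id|apply: is_diso_qis|apply: is_diso_inv].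
split.
- apply: deq_trans (deq_cancell _ _) _; exact: deq_sym (deq_idr _).
- exact: deq_cancelr.
apply: deq_trans (deq_idl _); apply: deq_congr; first exact: deq_refl.
exact: deq_map.
Qed.

End ChainLevel.

(** * Complexes with zero differential, and models of homology *)

Section GradedModules.
Variable R : comPzRingType.
Implicit Types (X T L M : complex R) (P : int -> lmodType R).

Definition graded P : complex R :=
  @Complex R P (fun=> \0) (fun _ _ => erefl).

(** The support is recorded by a list of degrees. Each step splits off one degree [a] as a shifted
    stalk and leaves 0 there in the remainder [P']; a degree that is repeated later in the list is
    dropped. *)
Lemma thick1_graded_seq (Q : lmodType R -> Prop) (s : seq int) P :
  (forall i, i \in s -> Q (P i)) -> (forall i, i \notin s -> trivial_module (P i)) ->
  thick1 (stalks Q) (graded P).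
Proof.
elim: s P => [|a s IHs] P QP P0.
  apply: thick1_iso (thick1_zero _); apply: diso_sym.
  pose f : chain_map (graded P) (zero_complex R) :=
    ChainMap (cmap := fun i => \0 : {linear graded P i -> zero_complex R i})
      (fun _ _ => erefl).
  apply: (@qis_diso _ _ _ f); apply: levelwise_qis => i => [x y _|y].
    by rewrite (P0 i isT x) (P0 i isT y).
  by exists 0; apply/rowP => -[].
have [sa|sNa] := boolP (a \in s).
  apply: IHs => i si; [apply: QP|apply: P0]; rewrite in_cons ?si ?orbT //.
  by rewrite negb_or si andbT; apply: contraNneq si => ->.
pose P' i := if i == a then ('rV[R]_0 : lmodType R) else P i.
pose A := shift a (stalk (P a)).
have /dchoice[phi phi_bij] : forall i, exists phi : {linear P i -> csum A (graded P') i},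
    injective phi /\ forall y, exists x, phi x = y.
  move=> i; rewrite /= /P' subr_eq0; case: eqVneq => [->|ia].
    have phiL : linear (fun x : P a => (x, 0 : 'rV[R]_0)).
      by move=> k x y; congr pair; rewrite /= scaler0 addr0.
    exists (mklin phiL); split=> [x y [] //|[x y]]; exists x.
    by congr pair; apply/rowP => -[].
  have phiL : linear (fun x : P i => (0 : 'rV[R]_0, x)).
    by move=> k x y; congr pair; rewrite /= scaler0 addr0.
  exists (mklin phiL); split=> [x y [] //|[x y]]; exists y.
  by congr pair; apply/rowP => -[].
have phi_diff i (x : graded P i) :
    phi (i - 1) (cdiff (graded P) x) = cdiff (csum A (graded P')) (phi i x).
  by rewrite /= linear0 /csum_diff /= /shift_diff /= !linear0.
apply: (@thick1_iso _ _ (csum A (graded P'))).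
  apply: diso_sym; apply: (@qis_diso _ _ _ (ChainMap phi_diff)).
  by apply: levelwise_qis => i; have [] := phi_bij i.
apply: thick1_sum.
  by apply/thick1_shift/thick1_incl/Stalk/QP; rewrite mem_head.
apply: IHs => i si; rewrite /P'; case: eqVneq => [ia|ia].
- by rewrite -ia si in sNa.
- by apply: QP; rewrite in_cons si orbT.
- by move=> x; apply/rowP => -[].
- by apply: P0; rewrite in_cons negb_or ia.
Qed.

Lemma thick1_graded (Q : lmodType R -> Prop) N P :
  (forall i, Q (P i)) -> (forall i, N%:Z < `|i| -> trivial_module (P i)) ->
  thick1 (stalks Q) (graded P).
Proof.
move=> QP P0.
(* The list enumerates the degrees from [-N] to [N]. *)
apply: (@thick1_graded_seq Q [seq k%:Z - N%:Z | k <- iota 0 (N + N).+1]) => // i.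
move=> iN; apply: P0; rewrite ltNge; apply: contra iN; rewrite ler_norml => /andP[l u].
have i0 : 0 <= i + N%:Z by rewrite -lerBlDr sub0r.
apply/mapP; exists (absz (i + N%:Z)); last by rewrite gez0_abs // addrK.
by rewrite mem_iota /= add0n ltnS -lez_nat gez0_abs // PoszD lerD2r.
Qed.

Lemma thick1_qis_summand (C : complex R -> Prop) L M T (q : chain_map (csum L M) T) :
  qis q -> thick1 C T -> thick1 C M.
Proof.
(* [thick1_summand] extracts the left summand, hence the swap. *)
move=> hq CT; apply: (@thick1_summand _ _ _ L).
apply: (thick1_iso (qis_diso (csum_swap_qis L M))).
exact: thick1_iso (diso_sym (qis_diso hq)) CT.
Qed.

(** In a degree written as [i - 1] the transport along degree equalities disappears; later proofs
    put degrees into this form for that purpose. *)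
Lemma is_boundaryP1 X i (z : cycle X (i - 1)) :
  z \in @is_boundary R X (i - 1) <-> exists y : X i, cdiff X y = val z.
Proof.
rewrite is_boundaryP; split=> [[j [e [y hy]]]|[y hy]]; last by exists i, erefl, y.
have ji : j = i by apply: (addIr (- 1)).
by case: i / ji e z hy => e z hy; exists y; rewrite -hy (eq_irrelevance e erefl).
Qed.

(** Presents [V] as the homology in degree [i] without a quotient, so that any isomorphic module,
    such as a kernel, can serve as the model. *)
Definition is_homology X i (V : lmodType R) (c : {linear cycle X i -> V}) : Prop :=
  (forall v, exists z, c z = v) /\ (forall z, c z = 0 <-> z \in @is_boundary R X i).

Definition homology_in (Q : lmodType R -> Prop) (N : nat) X : Prop :=
  forall i, exists V : lmodType R, [/\ Q V, N%:Z < `|i| -> trivial_module V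
    & exists c : {linear cycle X i -> V}, is_homology c].

End GradedModules.

(** * The cone of a map that is onto in homology *)

Section ProjectiveCover.
Variables (R : comPzRingType) (T : complex R) (P V : int -> lmodType R).
Variables (c : forall i, {linear cycle T i -> V i}) (e : forall i, {linear P i -> V i}).
Hypothesis cH : forall i, is_homology (c i).
Hypothesis esur : forall i v, exists x, e i x = v.
Variable f : forall i, {linear P i -> cycle T i}.
Hypothesis cf : forall i x, c i (f i x) = e i x.

Definition cover_fun i : {linear graded P i -> T i} := val \o f i.

Lemma cover_diff i (x : graded P i) :
  cover_fun (i - 1) (cdiff (graded P) x) = cdiff T (cover_fun i x).
Proof. by rewrite /= cycleP !linear0. Qed.

Definition cover : chain_map (graded P) T := ChainMap cover_diff.

(** By the long exact sequence: [cover] is onto in homology, so the homology of its cone is the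
    kernel of [e] one degree lower. The identification sends a cycle [(x, p)] to [p]. *)
Lemma cover_cone_homology i :
  exists c' : {linear cycle (cone cover) i -> kermod (e (i - 1))}, is_homology c'.
Proof.
have ez (z : cycle (cone cover) i) : e (i - 1) (val z).2 = 0.
  have := cycleP z; case: z => -[x p] zc /= [h _].
  rewrite -cf; apply/(cH _).2/is_boundaryP; exists i, erefl, (- x).
  by rewrite /= linearN; apply: addr0_eq h.
have c'L : linear (fun z => mkker (ez z)) by move=> a x y; apply: val_inj.
exists (mklin c'L); split=> [k|z].
  have /(cH _).2/is_boundaryP1[y hy] : c (i - 1) (f _ (val k)) = 0.
    by rewrite cf kerP.
  have zc : ((- y, val k) : cone cover i) \in @is_cycle R (cone cover) i.
    apply/eqP; rewrite /= /cone_diff /=; congr pair; last exact: oppr0.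
    by rewrite linearN hy addNr.
  by exists (Cycle zc); apply: val_inj.
rewrite is_boundaryP; split=> [/(congr1 val)/= z0|[j [e' [[y p] hy]]]]; last first.
  apply: val_inj; rewrite /= -hy; case: i / e' {z ez c'L hy} => /=.
  exact: oppr0.
have xc : (val z).1 \in @is_cycle R T i.
  apply/eqP; have := cycleP z; case: z z0 => -[x p] zc /= p0 [h _].
  by rewrite p0 !linear0 addr0 in h.
(* Here [x] is a cycle whose class is [e i p] for some [p]; then [x - f i p] is the boundary of some
   [y], and [(y, p)] bounds [(x, 0)] in the cone. *)
have [p pz] := esur (c i (Cycle xc)).
have /(cH _).2/is_boundaryP[j [e' [y hy]]] : c i (Cycle xc - f i p) = 0.
  by rewrite linearB cf pz subrr.
exists j, e'; case: i / e' p z z0 xc pz hy {ez c'L} => p z z0 xc pz /= hy.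
exists (y, p); rewrite /= /cone_diff /= hy subrK oppr0.
by rewrite -z0 -surjective_pairing.
Qed.

End ProjectiveCover.

Lemma cover_qis (R : comPzRingType) (T : complex R) (P V : int -> lmodType R)
    (c : forall i, {linear cycle T i -> V i}) (f : forall i, {linear P i -> cycle T i}) :
  (forall i, is_homology (c i)) -> (forall i, injective (c i \o f i)) ->
  (forall i v, exists x, c i (f i x) = v) -> qis (cover f).
Proof.
move=> cH cfinj cfsur; apply/qisP; split=> i => [z /(cH i).2|w].
  have -> : cycle_map (cover f) z = f i (val z) by apply: cycle_inj.
  move=> cfz; suff -> : z = 0 by exact: (is_boundary_submod _ i).1.
  by apply: cycle_inj; apply: (cfinj i); rewrite /= cfz !linear0.
have [x xw] := cfsur i (c i w).
have xc : x \in @is_cycle R (graded P) i by apply/eqP.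
exists (Cycle xc); apply/(cH i).2.
have -> : cycle_map (cover f) (Cycle xc) = f i x by apply: cycle_inj.
by rewrite linearB /= xw subrr.
Qed.

(** * The projective bound *)

Lemma ltr_norm_shift (N : nat) (i j : int) :
  `|i - j| <= 1 -> N.+1%:Z < `|i| -> N%:Z < `|j|.
Proof.
move=> ij Ni; rewrite -(ltrD2l 1); apply: lt_le_trans (_ : `|i - j| + `|j| <= _).
  by rewrite -PoszD add1n (lt_le_trans Ni) // -{1}(subrK j i) ler_normD.
by rewrite lerD2r.
Qed.

Section ProjectiveLevel.
Variable R : comPzRingType.

Lemma chain_id_qis (X : complex R) : qis (chain_id X).
Proof. by apply: levelwise_qis => i // y; exists y. Qed.

(** Induction on the length, replacing [T] by the cone of a projective cover of its homology. The
    extra summand [L] enters only in the outermost triangle; further in it is the zero complex. *)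
Lemma thick_proj n N (T L M : complex R) (q : chain_map (csum L M) T) :
  homology_in (@has_proj_resolution R ^~ n) N T -> qis q ->
  thick (stalks (@projective_module R)) n.+1 M.
Proof.
elim: n N T L M q => [|n IHn] N T L M q /dchoice[V hV] hq.
  have /dchoice[c cH] : forall i, exists c : {linear cycle T i -> V i}, is_homology c.
    by move=> i; case: (hV i).
  have Vproj i : projective_module (V i).
    by case: (hV i) => /proj_resolution0.
  (* Projectivity splits the surjection from cycles to homology, so [T] is quasi-isomorphic to its
     homology. *)
  have /dchoice[f cf] i := Vproj i _ _ (c i) idfun (cH i).1.
  apply: (thick1_qis_summand hq); apply: (@thick1_iso _ _ (graded V)).
    apply/qis_diso/(cover_qis (f := f) cH) => i.
      by move=> x y /=; rewrite !cf.
    by move=> v; exists v; rewrite cf.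
  by apply: (@thick1_graded _ _ N) => // i; case: (hV i).
have /dchoice[c cH] : forall i, exists c : {linear cycle T i -> V i}, is_homology c.
  by move=> i; case: (hV i).
have /dchoice[P /dchoice[e Pe]] : forall i, exists (P : lmodType R) (e : {linear P -> V i}),
    [/\ projective_module P, forall v, exists x, e x = v,
        has_proj_resolution (kermod e) n & N%:Z < `|i| -> trivial_module P].
  move=> i; have [resV V0 _] := hV i.
  (* A zero module is covered by itself, which keeps the cover bounded even if the given resolution
     is not minimal. *)
  have [{}V0|VN0] := pselect (trivial_module (V i)).
    exists (V i), idfun; split=> //; first exact: trivial_projective.
      by move=> v; exists v.
    by apply: trivial_proj_resolution => k; apply: val_inj; apply: V0.
  have [P [e [Pp esur resK]]] := proj_resolutionS resV.
  by exists P, e; split=> // /V0.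
have /dchoice[f cf] : forall i, exists f : {linear P i -> cycle T i},
    forall x, c i (f x) = e i x.
  by move=> i; have [Pp _ _ _] := Pe i; apply: Pp (cH i).1.
apply: (thickS (f := cover f) (chain_id_qis _) hq).
  by apply: (@thick1_graded _ _ N) => i; case: (Pe i).
(* The kernels sit one degree higher in the cone, so the window of degrees grows by one. *)
apply: (IHn N.+1 _ _ _ _ _ (csum_zero_qis _)) => i.
exists (kermod (e (i - 1))); split.
- by case: (Pe (i - 1)).
- move=> Ni k; apply: val_inj; case: (Pe (i - 1)) => _ _ _; apply.
  by apply: ltr_norm_shift Ni; rewrite opprB addrC subrK.
- apply: (cover_cone_homology cH _ cf) => j; by case: (Pe j).
Qed.
End ProjectiveLevel.

(** * Iterated cones and their peeling from the inside *)

Lemma int_pred_surj (i : int) : exists j : int, j - 1 = i.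
Proof. by exists (i + 1); rewrite addrK. Qed.

Section IteratedCones.
Variables (R : comPzRingType) (C : complex R -> Prop).
Implicit Types K L M N S T : complex R.

(** Each layer [K] enters as the quotient [shift 1 K] of the cone, whereas [thick] wants its
    [thick1] term at the first vertex of the triangle. *)
Fixpoint iterated_cone (n : nat) S : Prop :=
  match n with
  | 0 => thick1 C S
  | n'.+1 => exists K S' (f : chain_map K S'),
      [/\ S = cone f, thick1 C K & iterated_cone n' S']
  end.

Lemma cone_short_exact K S (f : chain_map K S) :
  short_exact (cone_in f) (cone_out f).
Proof.
split=> i => [x y [] //|k|[s k] /=]; first by exists (0, k).
by split=> [->|[t [_ <-]] //]; exists s.
Qed.

Definition cone_map_fun I S N (f : chain_map I S) (p : chain_map S N) i
  (x : cone f i) : cone (chain_comp p f) i := (p i x.1, x.2).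

Lemma cone_map_linear I S N (f : chain_map I S) (p : chain_map S N) i :
  linear (@cone_map_fun I S N f p i).
Proof. by move=> a x y; congr pair; rewrite /= linearP. Qed.

Lemma cone_map_diff I S N (f : chain_map I S) (p : chain_map S N) i (x : cone f i) :
  mklin (@cone_map_linear I S N f p (i - 1)) (cdiff (cone f) x) =
  cdiff (cone (chain_comp p f)) (mklin (@cone_map_linear I S N f p i) x).
Proof. by rewrite /= /cone_map_fun /cone_diff /= linearD cmap_diff. Qed.

Definition cone_map I S N (f : chain_map I S) (p : chain_map S N) :
  chain_map (cone f) (cone (chain_comp p f)) := ChainMap (@cone_map_diff I S N f p).

(** In each degree the cone is [S] plus a shifted copy of [I], and dividing out [K] affects only the
    [S] component. *)
Lemma cone_map_short_exact I K S N (f : chain_map I S)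
    (k : chain_map K S) (p : chain_map S N) :
  short_exact k p -> short_exact (chain_comp (cone_in f) k) (cone_map f p).
Proof.
case=> kinj psur ex; split=> i => [x y [] /kinj //|[n a]|[s a]].
  by have [s <-] := psur i n; exists (s, a).
split=> [[/ex[x <-] ->]|[x [<- <-]]]; first by exists x.
by congr pair; apply/ex; exists x.
Qed.

(* The outermost cone has the innermost layer as its first subcomplex: this
   reassociation replaces the octahedral axiom. *)
Lemma iterated_cone_sub n S : iterated_cone n.+1 S ->
  exists K N (k : chain_map K S) (p : chain_map S N),
    [/\ short_exact k p, thick1 C K & iterated_cone n N].
Proof.
elim: n S => [|n IHn] S [I [S' [f [-> CI]]]] hS'.
  exists S', (shift 1 I), (cone_in f), (cone_out f).
  by split=> //; [apply: cone_short_exact|apply: thick1_shift].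
have [K [N [k [p [kp CK hN]]]]] := IHn _ hS'.
exists K, (cone (chain_comp p f)), (chain_comp (cone_in f) k), (cone_map f p).
split=> //; first exact: cone_map_short_exact.
by exists I, N, (chain_comp p f).
Qed.

(** The cone of the inclusion of the innermost layer is quasi-isomorphic to the quotient [N], which
    has one layer fewer. *)
Lemma thick_iterated_cone n S L M (q : chain_map (csum L M) S) :
  iterated_cone n S -> qis q -> thick C n.+1 M.
Proof.
elim: n S L M q => [|n IHn] S L M q hS hq; first exact: thick1_qis_summand hq hS.
have [K [N [k [p [kp CK hN]]]]] := iterated_cone_sub hS.
apply: (thickS (cone_proj_qis kp) hq CK).
exact: IHn hN (csum_zero_qis N).
Qed.

End IteratedCones.

(** * The fibre of a map into a graded module that is injective in homology *)

Section InjectiveExtension.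
Variables (R : comPzRingType) (T : complex R) (I : int -> lmodType R).
Variable g : forall i, {linear T i -> I (i - 1)}.
Hypothesis gd : forall i (y : T i), g (i - 1) (cdiff T y) = 0.
Hypothesis g_bd : forall i (z : cycle T i), g i (val z) = 0 -> z \in @is_boundary R T i.

Definition ext_diff i (x : I i * T i) : I (i - 1) * T (i - 1) :=
  (g i x.2, cdiff T x.2).

Lemma ext_diff_linear i : linear (@ext_diff i).
Proof. by move=> a x y; rewrite /ext_diff /= !linearP. Qed.

Lemma ext_diffK i (x : I i * T i) :
  mklin (@ext_diff_linear (i - 1)) (mklin (@ext_diff_linear i) x) = 0.
Proof. by rewrite /= /ext_diff /= gd cdiffK. Qed.

(* The fibre of [g : T -> shift 1 (graded I)]. *)
Definition ext : complex R :=
  Complex (fun i => (I i * T i)%type : lmodType R) _ ext_diffK.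

Definition ext_in_fun i (b : graded I i) : ext i := (b, 0).

Lemma ext_in_linear i : linear (@ext_in_fun i).
Proof. by move=> a x y; congr pair; rewrite /= scaler0 addr0. Qed.

Lemma ext_in_diff i (b : graded I i) :
  mklin (@ext_in_linear (i - 1)) (cdiff (graded I) b) =
  cdiff ext (mklin (@ext_in_linear i) b).
Proof. by rewrite /= /ext_diff /= !linear0. Qed.

Definition ext_in : chain_map (graded I) ext := ChainMap ext_in_diff.

(** By the long exact sequence: [g] is injective in homology by [g_bd], so the homology of the fibre
    is the cokernel of [g] on cycles, which [p] presents. *)
Lemma ext_homology i (C : lmodType R) (p : {linear I i -> C}) :
  (forall x, exists b, p b = x) ->
  (forall j (e : j - 1 = i) (b : I (j - 1)),
     p (eq_rect _ (fun k => I k) b _ e) = 0 <-> exists z : cycle T j, g j (val z) = b) ->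
  exists c : {linear cycle ext i -> C}, is_homology c.
Proof.
have [j ji] := int_pred_surj i; case: i / ji p => p psur /(_ j erefl)/= pg.
(* A cycle [(b, y)] has [y] bounding some [u], and is homologous to [(b - g j u, 0)]. Two choices of
   [u] differ by a cycle, whose image under [g] is killed by [p]. *)
pose val_c (z : cycle ext (j - 1)) x :=
  exists u : T j, cdiff T u = (val z).2 /\ x = p ((val z).1 - g j u).
have val_c_uniq z x y : val_c z x -> val_c z y -> x = y.
  move=> [u [hu ->]] [v [hv ->]]; apply/eqP; rewrite -subr_eq0 -linearB /=; apply/eqP/pg.
  have vu : v - u \in @is_cycle R T j by apply/eqP; rewrite linearB hu hv subrr.
  exists (Cycle vu); rewrite linearB /=; move: (g j v) (g j u) (val z).1 => a b c.
  by rewrite opprB [RHS]addrC subrKA.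
have /choice[c hc] z : exists x, val_c z x.
  have := cycleP z; case: z => -[b y] zc /= [gy dy].
  have yc : y \in @is_cycle R T (j - 1) by apply/eqP.
  have /is_boundaryP1[u hu] : Cycle yc \in @is_boundary R T _ by apply: g_bd.
  by exists (p (b - g j u)), u.
have cL : linear c.
  move=> a x y; apply: val_c_uniq (hc _) _.
  have [[u [hu ->]] [v [hv ->]]] := (hc x, hc y).
  exists (a *: u + v); split; first by rewrite linearP hu hv.
  by rewrite -linearP; congr (p _); rewrite linearP scalerBr opprD addrACA.
exists (mklin cL); split=> [x|z].
  have [b <-] := psur x.
  have zc : (b, 0) \in @is_cycle R ext (j - 1).
    by apply/eqP; rewrite /= /ext_diff /= !linear0.
  exists (Cycle zc); apply: val_c_uniq (hc _) _.
  by exists 0; rewrite /= !linear0 addr0.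
rewrite is_boundaryP1; split=> [cz|[[b u] /= hz]].
  have [u [hu]] := hc z; rewrite [c z]cz => /esym/pg[y hy].
  exists (0, u + val y); rewrite /= /ext_diff /= !linearD hy cycleP addr0 hu.
  by rewrite (addrC (g j u)) subrK -surjective_pairing.
apply: val_c_uniq (hc _) _; exists u; rewrite /= -hz; split=> //.
by rewrite subrr linear0.
Qed.

Section Cone.
Variables (S : complex R) (q : chain_map ext S).

Let phi := chain_comp q ext_in.

(** The canonical map from [T] to the cone of [ext_in], followed by [q]. The sign cancels the term
    [q (g i y, 0)] in the differential of [q (0, y)]. *)
Definition ext_embed_fun i (y : T i) : cone phi i := (q i (0, y), - g i y).

Lemma ext_embed_linear i : linear (@ext_embed_fun i).
Proof.
move=> a x y; congr pair; rewrite /= ?linearP //= ?opprD ?scalerN //.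
rewrite -linearP; congr (q i _); congr pair.
by rewrite /= scaler0 addr0.
Qed.

Lemma ext_embed_diff i (y : T i) :
  mklin (@ext_embed_linear (i - 1)) (cdiff T y) =
  cdiff (cone phi) (mklin (@ext_embed_linear i) y).
Proof.
rewrite /= /ext_embed_fun /cone_diff /= gd; congr pair.
rewrite -(@cmap_diff _ _ _ q i (0, y)) -linearD /=; congr (q _ _); congr pair.
  by rewrite /= subrr.
by rewrite /= addr0.
Qed.

Definition ext_embed : chain_map T (cone phi) := ChainMap ext_embed_diff.

(** [T] is the cokernel of [ext_in], hence equivalent to its cone, and [q] preserves this. The proof
    chases elements, with [g_bd] turning cycles killed by [g] into boundaries. *)
Lemma ext_embed_qis : qis q -> qis ext_embed.
Proof.
move=> /qisP[qinj qsur]; apply/qisP; split=> i; have [j ji] := int_pred_surj i.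
  case: i / ji => z /is_boundaryP1[[s b] /=].
  rewrite /cone_diff /= oppr0 => -[_ gz]; apply: g_bd.
  by apply/oppr_inj; rewrite -gz oppr0.
case: i / ji => -[[s b] hw].
have ds : - cdiff S s = q _ (b, 0).
  by move/eqP: (hw) => [] /addr0_eq.
have bc : (b, 0) \in @is_cycle R ext (j - 1 - 1).
  by apply/eqP; rewrite /= /ext_diff /= !linear0.
(* The image of [(b, 0)] bounds in [S], so [(b, 0)] bounds in [ext]; this yields a cycle [y'] with
   [g y' = b], and adding [q (0, y')] to [s] gives a cycle of [S]. *)
have /qinj/is_boundaryP1[[b' y'] [gy' dy']] : cycle_map q (Cycle bc) \in @is_boundary R S _.
  by apply/is_boundaryP1; exists (- s); rewrite linearN.
have y'c : y' \in @is_cycle R T (j - 1) by apply/eqP.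
have s'c : s + q _ (0, y') \in @is_cycle R S (j - 1).
  apply/eqP; rewrite linearD /= -(@cmap_diff _ _ _ q _ (0, y')) /= /ext_diff /= gy' dy' -ds.
  exact: subrr.
(* The corrected cycle is homologous to [q (b2, y2)]. As [y2] bounds [u], this class comes from [I]
   and vanishes in the cone, so [- y'] represents the given class. *)
have [[[b2 y2] hz] /is_boundaryP1[v /= hv]] := qsur _ (Cycle s'c).
have [gy2 dy2] : g _ y2 = 0 /\ cdiff T y2 = 0 by move/eqP: (hz) => [].
have y2c : y2 \in @is_cycle R T (j - 1) by apply/eqP.
have /is_boundaryP1[u hu] : Cycle y2c \in @is_boundary R T _ by apply: g_bd.
exists (- Cycle y'c); apply/is_boundaryP1; exists (v + q j (0, u), b2 - g j u).
rewrite /= /cone_diff /ext_embed_fun /ext_in_fun /= oppr0; congr pair; last first.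
  change (0 = b - - g _ (- y')); by rewrite opprK linearN gy' subrr.
change (cdiff S (v + q j (0, u)) + q (j - 1) (b2 - g j u, 0) = s - q _ (0, - y')).
rewrite linearD /= hv -(@cmap_diff _ _ _ q _ (0, u)) /= /ext_diff /= hu.
have -> : q (j - 1) (b2, y2) = q _ (g j u, y2) + q _ (b2 - g j u, 0).
  rewrite -linearD /=; congr (q _ _); congr pair; rewrite /= ?addr0 //.
  by rewrite (addrC (g j u)) subrK.
have -> : q (j - 1) (0, - y') = - q _ (0, y').
  by rewrite -linearN; congr (q _ _); congr pair; rewrite oppr0.
by rewrite opprK -addrA subrK.
Qed.

End Cone.
End InjectiveExtension.

(** * The injective bound *)

Section InjectiveLevel.
Variable R : comPzRingType.
Implicit Types (T L M S X : complex R).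

(** Boundaries are cycles, and on cycles [g] is [h]. This makes an extension from cycles to chains a
    chain map into a complex with zero differential. *)
Lemma cycle_ext_boundary X i (W : lmodType R) (h : {linear cycle X i -> W})
    (g : {linear X i -> W}) :
  (forall z, g (val z) = h z) -> (forall z, z \in @is_boundary R X i -> h z = 0) ->
  forall j (e : j - 1 = i) (y : X j), g (tr X e (cdiff X y)) = 0.
Proof.
move=> gh h0 j e y; have yc : tr X e (cdiff X y) \in @is_cycle R X i.
  by apply/eqP; case: i / e {h g gh h0}; apply: cdiffK.
by rewrite (gh (Cycle yc)) h0 //; apply/is_boundaryP; exists j, e, y.
Qed.

(** Injectivity extends the map from cycles to homology to all chains; the extension is the desired
    quasi-isomorphism. *)
Lemma injective_embed N T : homology_in (@injective_module R) N T ->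
  exists (V : int -> lmodType R) (q : chain_map T (graded V)),
    qis q /\ thick1 (stalks (@injective_module R)) (graded V).
Proof.
move=> /dchoice[V hV].
have /dchoice[c cH] : forall i, exists c : {linear cycle T i -> V i}, is_homology c.
  by move=> i; case: (hV i).
have Vinj i : injective_module (V i) by case: (hV i).
have /dchoice[g gc] i := Vinj i _ _ val (c i) val_inj.
have gd i (y : T i) : g (i - 1) (cdiff T y) = cdiff (graded V) (g i y).
  by apply: (cycle_ext_boundary (gc _) _ erefl) => z /(cH _).2.
pose q : chain_map T (graded V) := @ChainMap _ T (graded V) g gd.
exists V, q; split; last first.
  by apply: (@thick1_graded _ _ N) => // i; case: (hV i).
apply/qisP; split=> i => [z /is_boundaryP[j [e [y]]]|w].
  by rewrite linear0 /= gc => /esym/(cH i).2.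
have [z zw] := (cH i).1 (val w); exists z.
suff -> : w - cycle_map q z = 0 by exact: (is_boundary_submod _ i).1.
apply: cycle_inj; change (val w - g i (val z) = 0).
by rewrite gc zw subrr.
Qed.

(** Here [i] is the degree in which [E] will sit, one below the homology it receives. Quantifying
    over all [j] with [j - 1 = i] allows instantiation at [erefl], free of transports. *)
Lemma inj_resolution_step n N T : homology_in (@has_inj_resolution R ^~ n.+1) N T ->
  forall i, exists (E C : lmodType R) (g : forall j, j - 1 = i -> {linear T j -> E})
      (p : {linear E -> C}),
    [/\ injective_module E, has_inj_resolution C n, forall x, exists b, p b = x,
        N.+1%:Z < `|i| -> trivial_module E
      & forall j e, [/\ forall k (e' : k - 1 = j) (y : T k), g j e (tr T e' (cdiff T y)) = 0,
          forall z : cycle T j, g j e (val z) = 0 -> z \in @is_boundary R T j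
        & forall b, p b = 0 <-> exists z : cycle T j, g j e (val z) = b]].
Proof.
move=> hT i; have [j0 ji] := int_pred_surj i; case: i / ji.
have [V [resV V0 [c cH]]] := hT j0.
have [E [C [a [p [Einj ainj psur ap [resC E0]]]]]] :
  exists (E C : lmodType R) (a : {linear V -> E}) (p : {linear E -> C}),
    [/\ injective_module E, injective a, forall c, exists x, p x = c,
        exact_at a p & has_inj_resolution C n /\
        (N.+1%:Z < `|j0 - 1| -> trivial_module E)].
  (* A zero module is embedded in itself, so that the injectives stay bounded. *)
  have [{}V0|VN0] := pselect (trivial_module V).
    exists V, V, idfun, \0; split=> //; first exact: trivial_injective.
    - by move=> x; exists 0; rewrite linear0 [RHS]V0.
    - by move=> x; split=> _; [exists x|exact: V0].
    - by split=> //; apply: trivial_inj_resolution.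
  have [E [C [a [p [Einj ainj psur ap resC]]]]] := inj_resolutionS resV.
  exists E, C, a, p; split=> //; split=> // Nj; case: VN0; apply: V0.
  by apply: ltr_norm_shift Nj; rewrite addrAC subrr add0r normrN1.
have [gamma gammaE] := Einj _ _ (val : {linear cycle T j0 -> _}) (a \o c) val_inj.
exists E, C, (fun j e => gamma \o tr T (addIr (- 1) e)), p; split=> // j e.
have jj0 : j0 = j := esym (addIr (- 1) e); case: j / jj0 e => e.
have gE x : (gamma \o tr T (addIr (- 1) e)) x = gamma x by rewrite /= (tr_irr _ erefl).
split=> [k e' y|z|b].
- apply: etrans (gE _) _; apply: (cycle_ext_boundary gammaE) => z /cH.2 /= ->.
  exact: linear0.
- move/(etrans (esym (gE _))); rewrite gammaE /= => az.
  by apply/cH.2/ainj; rewrite az linear0.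
- split=> [/ap[v <-]|[z <-]].
    by have [z <-] := cH.1 v; exists z; apply: etrans (gE _) (gammaE z).
  by rewrite [X in p X = 0](etrans (gE _) (gammaE z)); apply/ap; exists (c z).
Qed.

(** Induction through the fibre [ext], whose homology consists of the cosyzygies. The
    quasi-isomorphism points out of the fibre, so it composes with [ext_in] as a chain map. *)
Lemma injective_tower n N T : homology_in (@has_inj_resolution R ^~ n) N T ->
  exists S (q : chain_map T S),
    qis q /\ iterated_cone (stalks (@injective_module R)) n S.
Proof.
elim: n N T => [|n IHn] N T hT.
  have [|V [q hq]] := @injective_embed N T; last by exists (graded V), q.
  move=> i; have [V [resV V0 cH]] := hT i.
  by exists V; split=> //; apply: inj_resolution0.
have /dchoice[I /dchoice[C /dchoice[G /dchoice[p IC]]]] := inj_resolution_step hT.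
pose g i := G (i - 1) i erefl.
have gd i (y : T i) : g (i - 1) (cdiff T y) = 0.
  by have [_ _ _ _ /(_ _ erefl)[/(_ _ erefl y)]] := IC (i - 1 - 1).
have g_bd i (z : cycle T i) : g i (val z) = 0 -> z \in @is_boundary R T i.
  by have [_ _ _ _ /(_ _ erefl)[_ /(_ z)]] := IC (i - 1).
have [|S [q [hq hS]]] := IHn N.+1 (ext gd).
  move=> i; have [_ Cres psur I0 _] := IC i.
  exists (C i); split=> //.
    by move=> /I0 {}I0 x; have [b <-] := psur x; rewrite (I0 b) linear0.
  apply: (ext_homology gd g_bd psur) => j e b; case: i / e {Cres psur I0}.
  by have [_ _ _ _ /(_ _ erefl)[_ _ /(_ b)]] := IC (j - 1).
exists (cone (chain_comp q (ext_in gd))), (ext_embed q); split.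
  exact: (@ext_embed_qis _ _ _ _ gd g_bd _ q hq).
exists (graded I), S, (chain_comp q (ext_in gd)); split=> //.
by apply: (@thick1_graded _ _ N.+1) => i; case: (IC i).
Qed.

Lemma thick_inj n N L M : homology_in (@has_inj_resolution R ^~ n) N (csum L M) ->
  thick (stalks (@injective_module R)) n.+1 M.
Proof. by move=> /injective_tower[S [q [hq hS]]]; apply: thick_iterated_cone hS hq. Qed.

End InjectiveLevel.

(** * Padding the homology in each degree to the full direct sum *)

Section DirectSumModel.
Variable R : comPzRingType.

Lemma homology_class_linear (X : complex R) i : linear (@homology_class R X i).
Proof.
by move=> a x y; rewrite /homology_class quot_piD quot_piZ.
Qed.

Lemma homology_class_eq0 (X : complex R) i (z : cycle X i) :
  homology_class z = 0 <-> z \in @is_boundary R X i.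
Proof.
rewrite -[0](linear0 (mklin (@homology_class_linear X i))) /=.
by rewrite /homology_class quot_piE subr0.
Qed.

Variables (I : Type) (V : I -> lmodType R).

Definition dsum_single_fun i (x : V i) : dprod V := fun k =>
  if pselect (i = k) is left e then eq_rect i (fun k => V k) x k e else 0.

Lemma dsum_single_fin i (x : V i) : dsum_single_fun x \in fin_supp (V := V).
Proof.
apply/asboolP; apply: (sub_finite_set _ (finite_set1 i)) => k /=.
by rewrite /dsum_single_fun; case: pselect => // ->.
Qed.

Definition dsum_single i (x : V i) : dsum V := Dsum (dsum_single_fin x).

Lemma dsum_single_linear i : linear (@dsum_single i).
Proof.
move=> a x y; apply: val_inj; apply: functional_extensionality_dep => k /=.
change (dsum_single_fun (a *: x + y) k =
  a *: dsum_single_fun x k + dsum_single_fun y k).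
rewrite /dsum_single_fun; case: pselect => [e|_]; first by case: k / e.
by rewrite scaler0 addr0.
Qed.

Lemma dsum_proj_linear i : linear (fun s : dsum V => dsum_val s i).
Proof. by []. Qed.

Lemma dsum_singleK i (x : V i) : dsum_val (dsum_single x) i = x.
Proof.
rewrite /= /dsum_single_fun; case: pselect => // e.
by rewrite (Prop_irrelevance e erefl).
Qed.

(** [dsum_single] splits the projection to [V i], so the kernel of the projection is a
    complement. *)
Lemma dsum_complement i : exists (L : lmodType R)
    (a : {linear L -> dsum V}) (b : {linear V i -> dsum V}),
  (forall s, exists l x, a l + b x = s) /\
  (forall l x, a l + b x = 0 -> l = 0 /\ x = 0).
Proof.
pose pr := mklin (@dsum_proj_linear i).
exists (kermod pr), (ker_incl pr), (mklin (@dsum_single_linear i)); split=> [s|l x lx].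
  have k : pr (s - dsum_single (pr s)) = 0.
    by rewrite linearB; apply/eqP; rewrite subr_eq0; apply/eqP/esym/dsum_singleK.
  by exists (mkker k), (pr s); rewrite /= subrK.
have x0 : x = 0.
  have := congr1 pr lx; rewrite linearD linear0 [pr _]kerP add0r => <-.
  exact/esym/dsum_singleK.
split=> //; apply: val_inj; move: lx; rewrite x0 linear0 addr0; exact.
Qed.

End DirectSumModel.

(** A complement of [H_i(M)] placed in degree [i] completes the homology there to the whole sum.
    Where [H_i(M)] vanishes nothing is added, which keeps the result bounded; [Q0] covers these
    degrees. *)
Lemma homology_in_csum (R : comPzRingType) (Q : lmodType R -> Prop) (M : complex R) :
  (forall V : lmodType R, trivial_module V -> Q V) -> Q (homology_sum M) ->
  bounded_homology M -> exists N L, homology_in Q N (csum L M).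
Proof.
move=> Q0 QM [N HN]; exists N.
have /dchoice[L hL] : forall i, exists L V : lmodType R,
    exists (a : {linear L -> V}) (b : {linear homology M i -> V}),
    [/\ Q V, N%:Z < `|i| -> trivial_module V, forall v, exists l x, a l + b x = v
      & forall l x, a l + b x = 0 -> l = 0 /\ x = 0].
  move=> i; have [H0|HN0] := pselect (trivial_module (homology M i)).
    have Z0 : trivial_module ('rV[R]_0 : lmodType R) by move=> x; apply/rowP => -[].
    exists ('rV[R]_0 : lmodType R), ('rV[R]_0 : lmodType R), idfun, \0; split=> //.
    - exact: Q0.
    - by move=> v; exists v, 0; rewrite linear0 addr0.
  have [L [a [b [ab_sur ab_inj]]]] := dsum_complement (homology M) i.
  exists L, (homology_sum M), a, b; split=> //.
  by move=> /HN /HN0.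
exists (graded L) => i; have [V [a [b [QV V0 ab_sur ab_inj]]]] := hL i.
exists V; split=> //.
have mc (z : cycle (csum (graded L) M) i) : (val z).2 \in @is_cycle R M i.
  by apply/eqP; have := cycleP z => /= -[].
pose c (z : cycle (csum (graded L) M) i) : V := a (val z).1 + b (homology_class (Cycle (mc z))).
have cL : linear c.
  move=> k x y; rewrite /c.
  have -> : Cycle (mc (k *: x + y)) = k *: Cycle (mc x) + Cycle (mc y).
    exact: cycle_inj.
  by rewrite homology_class_linear !linearP /= scalerDr addrACA.
exists (mklin cL); split=> [v|z].
  have [l [x <-]] := ab_sur v.
  have zc : (l, val (quot_repr x)) \in @is_cycle R (csum (graded L) M) i.
    by apply/eqP; rewrite /= /csum_diff /= cycleP.
  exists (Cycle zc); rewrite /= /c /=; congr (a _ + b _).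
  rewrite -[RHS]quot_reprK; congr (quot_pi _ _); exact: cycle_inj.
split=> [/ab_inj[l0 /homology_class_eq0/is_boundaryP]|/is_boundaryP]; last first.
  move=> [j [e [[l y] hy]]]; rewrite /= /c.
  have -> : (val z).1 = 0 by rewrite -hy; case: _ / e {z hy}.
  have /homology_class_eq0-> : Cycle (mc z) \in @is_boundary R M i.
    apply/is_boundaryP; exists j, e, y; rewrite /= -hy.
    by case: _ / e {z hy}.
  by rewrite !linear0 addr0.
move=> [j [e [y /= hy]]]; apply/is_boundaryP; exists j, e, (0, y).
case: i / e z l0 hy {a b ab_sur ab_inj V0 mc c cL} => /= z l0 hy.
by rewrite /csum_diff /= hy -l0 -surjective_pairing.
Qed.

Theorem theoremB (R : comPzRingType) (hR : noetherian R)
    (M : complex R) (hM : bounded_homology M) :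
  (level (stalks (@projective_module R)) M <= proj_dim (homology_sum M) + 1%:E)%E /\
  (level (stalks (@injective_module R)) M <= inj_dim (homology_sum M) + 1%:E)%E.
Proof.
(* It remains to turn a resolution of length [n] into membership in [thick] at [n.+1]. *)
split; apply: einf_le_succ => n res.
  have res0 V : trivial_module V -> @has_proj_resolution R V n.
    exact: trivial_proj_resolution.
  have [N [L hL]] := homology_in_csum (Q := @has_proj_resolution R ^~ n) res0 res hM.
  by apply: thick_proj hL _; apply: chain_id_qis.
have res0 V : trivial_module V -> @has_inj_resolution R V n.
  exact: trivial_inj_resolution.
have [N [L hL]] := homology_in_csum (Q := @has_inj_resolution R ^~ n) res0 res hM.
exact: thick_inj hL.
Qed.
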